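(* Let $m<d$, let $A\in\mathbb{R}^{m\times d}$ have full row rank, let $c\in\mathbb{R}^d$ with $c>0$ (componentwise), and suppose that $A^T\lambda_0<c$ (componentwise) for some $\lambda_0\in\mathbb{R}^m$. Let $\Omega=\{x\in\mathbb{R}^d:x>0\}$, $s:=\prod_{j=1}^d c_j$, let $P(dx):=s\,e^{-\langle c,x\rangle}\,dx$ (a probability measure on $\Omega$), and let $$\Theta(y):=\inf_{Q\ll P}\Big\{D_{KL}(Q\Vert P):\ \int_\Omega Ax\,dQ(x)=y\Big\},\qquad \widetilde{\Theta}(y,\varepsilon):=\varepsilon\,\Theta(y/\varepsilon)\quad(\varepsilon>0),$$ where the infimum is over probability measures $Q$ on $\Omega$ absolutely continuous with respect to $P$. Let $y\in\mathrm{int}(A\mathbb{R}^d_+)$. Then for every $\varepsilon>0$, up to the constant $-\varepsilon\ln s$, $\widetilde{\Theta}(y,\varepsilon)$ is the optimal value $\tau_\varepsilon(y)$ of the log-barrier formulation of the dual linear program $\max_\lambda\{\langle\lambda,y\rangle:A^T\lambda\le c\}$; that is, $$\widetilde{\Theta}(y,\varepsilon)=-\varepsilon\ln s+\tau_\varepsilon(y),\qquad \tau_\varepsilon(y):=\sup_{\lambda\in\mathbb{R}^m}\Big\{\langle\lambda,y\rangle+\varepsilon\sum_{j=1}^d\ln(c-A^T\lambda)_j:\ A^T\lambda<c\Big\}.$$ In addition, $\widetilde{\Theta}(y,0):=\lim_{r\downarrow0}r\,\Theta(y/r)$ satisfies $\widetilde{\Theta}(y,0)=\tau(y)$, where $\tau(y):=\min_{x\ge0}\{\langle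 c,x\rangle: Ax=y\}$ is the optimal value of the primal linear program.
   Context: $\mathbb{R}^d_+=\{x\in\mathbb{R}^d:x\ge0\}$ and $A\mathbb{R}^d_+=\{Ax:x\in\mathbb{R}^d_+\}\subset\mathbb{R}^m$. For probability measures $Q(dx)=q(x)dx\ll P(dx)=p(x)dx$ on $\Omega$, $D_{KL}(Q\Vert P)=\int_\Omega q\ln(q/p)\,dx$. The function $(y,\varepsilon)\mapsto\widetilde\Theta(y,\varepsilon)$ is called the perspective function of $\Theta$. *)

(* Defs.v *)
From HB Require Import structures.
From mathcomp Require Import all_boot all_order all_algebra.
From mathcomp Require Import all_classical all_reals all_analysis.
From mathcomp Require Import measurable_realfun measurable_fun_approximation.

Set Implicit Arguments.
Unset Strict Implicit.
Unset Printing Implicit Defensive.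

Import Order.TTheory GRing.Theory Num.Theory.
Import numFieldNormedType.Exports.

Local Open Scope classical_set_scope.
Local Open Scope ring_scope.

Section tuple_cons.
Context {d : measure_display} {T : measurableType d} (n : nat).

Definition cons2tuple (p : T * n.-tuple T) : n.+1.-tuple T :=
  [tuple of p.1 :: p.2].

Definition uncons_tuple (t : n.+1.-tuple T) : T * n.-tuple T :=
  (thead t, [tuple of behead t]).

Lemma cons2tupleK : cancel cons2tuple uncons_tuple.
Proof.
by move=> [x t]; congr pair; exact: val_inj.
Qed.

Lemma measurable_cons2tuple : measurable_fun [set: T * n.-tuple T] cons2tuple.
Proof. by apply: measurable_cons; [exact: measurable_fst|exact: measurable_snd]. Qed.

Lemma measurable_uncons_tuple : measurable_fun [set: n.+1.-tuple T] uncons_tuple.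
Proof.
by apply: measurable_fun_pair; [exact: measurable_tnth|exact: measurable_behead].
Qed.

End tuple_cons.

Section cons_measure.
Local Open Scope ereal_scope.
Context {d : measure_display} {T : measurableType d} {R : realType} (n : nat).
Variables (m1 : {sigma_finite_measure set T -> \bar R}).
Variables (m2 : {sigma_finite_measure set (n.-tuple T) -> \bar R}).

Definition cons_measure : set (n.+1.-tuple T) -> \bar R :=
  pushforward (m1 \x m2) (@cons2tuple _ T n).

Let cons_measure0 : cons_measure set0 = 0.
Proof. by rewrite /cons_measure /pushforward preimage_set0 measure0. Qed.

Let cons_measure_ge0 A : 0 <= cons_measure A.
Proof. by rewrite /cons_measure /pushforward; exact: measure_ge0. Qed.

Let cons_measure_sigma_additive : semi_sigma_additive cons_measure.
Proof.
have mf := @measurable_cons2tuple _ T n.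
move=> F mF tF mUF; rewrite /cons_measure /pushforward preimage_bigcup.
apply: measure_semi_sigma_additive.
- by move=> k; rewrite -[X in measurable X]setTI; exact: mf.
- apply/trivIsetP => /= i j _ _ ij; rewrite -preimage_setI.
  by move/trivIsetP : tF => /(_ _ _ _ _ ij) ->//; rewrite preimage_set0.
- by rewrite -preimage_bigcup -[X in measurable X]setTI; exact: mf.
Qed.

HB.instance Definition _ := isMeasure.Build _ _ _ cons_measure
  cons_measure0 cons_measure_ge0 cons_measure_sigma_additive.

Let cons_measure_sigma_finite : sigma_finite setT cons_measure.
Proof.
have /sigma_finiteP[F [TF ndF Foo]] := sigma_finiteT m1.
have /sigma_finiteP[G [TG ndG Goo]] := sigma_finiteT m2.
exists (fun k => @uncons_tuple _ T n @^-1` (F k `*` G k)).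
  rewrite -preimage_bigcup (_ : \bigcup_k _ = setT) ?preimage_setT//.
  apply/seteqP; split=> // -[x t] _ /=.
  have [i _ Fix] : (\bigcup_i F i) x by rewrite -TF.
  have [j _ Gjt] : (\bigcup_j G j) t by rewrite -TG.
  exists (maxn i j) => //; split => /=.
  - by move: x Fix; exact/subsetPset/ndF/leq_maxl.
  - by move: t Gjt; exact/subsetPset/ndG/leq_maxr.
move=> k; have [mF Foo'] := Foo k; have [mG Goo'] := Goo k.
split.
  rewrite -[X in measurable X]setTI.
  by apply: measurable_uncons_tuple => //; exact: measurableX.
rewrite /cons_measure /pushforward -comp_preimage.
rewrite (_ : _ \o _ = id); last by apply/funext => x; exact: cons2tupleK.
by rewrite preimage_id product_measure1E// lte_mul_pinfty// ge0_fin_numE.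
Qed.

HB.instance Definition _ := Measure_isSigmaFinite.Build _ _ _ cons_measure
  cons_measure_sigma_finite.

End cons_measure.

(* R^n as a measurable space; tuples carry the product (= Borel) sigma-algebra,
   which matrices lack, so sample points are tuples and [vec] below turns them
   into column vectors. *)
Notation Rn R n := (n.-tuple (measurableTypeR R)).

(* n-dimensional Lebesgue measure, as the n-fold product of the Lebesgue
   measure on the line. *)
Fixpoint lebesgue_tuple (R : realType) (n : nat) :
    {sigma_finite_measure set (Rn R n) -> \bar R} :=
  match n with
  | 0 => \d_([tuple] : Rn R 0)
  | k.+1 => cons_measure (@lebesgue_measure R) (lebesgue_tuple R k)
  end.

Section defs.
Context {R : realType}.

Definition vec n (x : Rn R n) : 'cV[R]_n := \col_j tnth x j.

Definition dotp n (u v : 'cV[R]_n) : R := \sum_j u j 0 * v j 0.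

Definition ltv n (u v : 'cV[R]_n) : Prop := forall j, u j 0 < v j 0.

Definition lev n (u v : 'cV[R]_n) : Prop := forall j, u j 0 <= v j 0.

Definition cone m d (A : 'M[R]_(m, d)) : set 'cV[R]_m :=
  [set A *m x | x in [set x | lev 0 x]].

Definition Omega d : set (Rn R d) := [set x | ltv 0 (vec x)].

Definition exp_const d (c : 'cV[R]_d) : R := \prod_j c j 0.

Definition exp_density d (c : 'cV[R]_d) : Rn R d -> R :=
  (fun x => exp_const c * expR (- dotp c (vec x))) \_ (@Omega d).

Definition exp_measure d (c : 'cV[R]_d) : set (Rn R d) -> \bar R :=
  fun B => (\int[lebesgue_tuple R d]_(x in B) (exp_density c x)%:E)%E.

Definition has_density d (Q : set (Rn R d) -> \bar R) (q : Rn R d -> R) : Prop :=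
  [/\ measurable_fun setT q, (forall x, 0 <= q x) &
      forall B, measurable B ->
        Q B = (\int[lebesgue_tuple R d]_(x in B) (q x)%:E)%E].

(* Since 0 * r = 0, the integrand vanishes where q does (0 ln 0 = 0). *)
Definition KL d (q p : Rn R d -> R) : \bar R :=
  (\int[lebesgue_tuple R d]_(x in @Omega d) (q x * ln (q x / p x))%:E)%E.

(* Integrability is required explicitly: the library's integral is total. *)
Definition has_mean m d (A : 'M[R]_(m, d)) (Q : set (Rn R d) -> \bar R)
    (y : 'cV[R]_m) : Prop :=
  forall i, Q.-integrable setT (fun x => ((A *m vec x) i 0)%:E) /\
            (\int[Q]_x ((A *m vec x) i 0)%:E = (y i 0)%:E)%E.

(* Q is a probability measure on R^d; Q `<< exp_measure c forces Q to be carried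
   by Omega and, by Radon-Nikodym, to have a density q, which is unique almost
   everywhere, so KL does not depend on its choice. *)
Definition Theta m d (A : 'M[R]_(m, d)) (c : 'cV[R]_d) (y : 'cV[R]_m) : \bar R :=
  ereal_inf [set v | exists (Q : probability (Rn R d) R) (q : Rn R d -> R),
    [/\ Q `<< exp_measure c, has_density Q q, has_mean A Q y &
        v = KL q (exp_density c)]].

Definition persp_Theta m d (A : 'M[R]_(m, d)) (c : 'cV[R]_d) (y : 'cV[R]_m)
    (eps : R) : \bar R :=
  (eps%:E * Theta A c (eps^-1 *: y))%E.

Definition barrier_value m d (A : 'M[R]_(m, d)) (c : 'cV[R]_d) (y : 'cV[R]_m)
    (eps : R) : \bar R :=
  ereal_sup [set (dotp l y + eps * \sum_j ln ((c - A^T *m l) j 0))%:E |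
    l in [set l : 'cV[R]_m | ltv (A^T *m l) c]].

Definition lp_feasible m d (A : 'M[R]_(m, d)) (y : 'cV[R]_m) : set 'cV[R]_d :=
  [set x | lev 0 x /\ A *m x = y].

Definition lp_value m d (A : 'M[R]_(m, d)) (c : 'cV[R]_d) (y : 'cV[R]_m) :
    \bar R :=
  ereal_inf [set (dotp c x)%:E | x in lp_feasible A y].

End defs.

Section exp_measureT.
Context {R : realType}.

Lemma measurable_prod_tnth n (f : 'I_n -> R -> R) :
  (forall i, measurable_fun setT (f i)) ->
  measurable_fun setT (fun x : Rn R n => \prod_i f i (tnth x i)).
Proof.
move=> mf; apply: measurable_prod => i _.
apply: (@measurableT_comp _ _ _ _ _ _ (f i)) => //; exact: measurable_tnth.
Qed.

Lemma integral_lebesgue_tuple_prod n (f : 'I_n -> R -> R) :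
  (forall i, measurable_fun setT (f i)) -> (forall i x, 0 <= f i x) ->
  (\int[lebesgue_tuple R n]_x (\prod_i f i (tnth x i))%:E =
   \prod_i \int[@lebesgue_measure R]_x (f i x)%:E)%E.
Proof.
elim: n f => [|n IH] f mf f0.
  rewrite /= integral_dirac//=; last first.
    by under eq_fun do rewrite big_ord0; exact: measurable_cst.
  by rewrite !big_ord0 diracT mul1e.
rewrite /= ge0_integral_pushforward//=; first last.
- by move=> x _; rewrite lee_fin; apply: prodr_ge0.
- by apply/measurable_EFinP; exact: measurable_prod_tnth.
- exact: measurable_cons2tuple.
rewrite preimage_setT fubini_tonelli1//=; first last.
- by move=> x; rewrite lee_fin; apply: prodr_ge0.
- apply/measurable_EFinP.
  apply: (@measurableT_comp _ _ _ _ _ _ (fun x : Rn R n.+1 => \prod_i f i (tnth x i))).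
    exact: measurable_prod_tnth.
  exact: measurable_cons2tuple.
rewrite /fubini_F /=.
have E x : (\int[lebesgue_tuple R n]_y
   (\prod_(i < n.+1) f i (tnth (cons2tuple (x, y)) i))%:E =
   (f ord0 x)%:E * \prod_(i < n) \int[@lebesgue_measure R]_x (f (lift ord0 i) x)%:E)%E.
  rewrite -(IH (fun i => f (lift ord0 i)))// -ge0_integralZl//=.
  - apply: eq_integral => y _; rewrite big_ord_recl -EFinM /=.
    congr (_ * _)%:E; apply: eq_bigr => i _.
    by rewrite /cons2tuple tnthS /=; congr (f _ _); congr tnth; exact: val_inj.
  - apply/measurable_EFinP.
    by apply: (@measurable_prod_tnth _ (fun i => f (lift ord0 i))).
  - by move=> y _; rewrite lee_fin; apply: prodr_ge0.
  - by rewrite lee_fin.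
under eq_integral do rewrite E.
rewrite ge0_integralZr//=.
- by rewrite big_ord_recl.
- by apply/measurable_EFinP; exact: mf.
- by move=> x _; rewrite lee_fin.
- by apply: prode_ge0 => i _; apply: integral_ge0 => x _; rewrite lee_fin.
Qed.

Lemma exp_densityE d (c : 'cV[R]_d) (hc : ltv 0 c) x :
  exp_density c x =
  \prod_j ((fun t => c j 0 * expR (- c j 0 * t)) \_ `]0, +oo[) (tnth x j).
Proof.
rewrite /exp_density patchE; case: ifPn => [|].
  rewrite inE => xO.
  rewrite /exp_const /dotp -sumrN expR_sum -big_split/=; apply: eq_bigr => j _.
  rewrite patchE ifT; last first.
    by rewrite inE /= in_itv/= andbT; have := xO j; rewrite !mxE.
  by rewrite mulNr !mxE.
move=> xO.
have [j xj] : exists j, ~~ (0 < tnth x j).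
  apply/existsP; rewrite -negb_forall; apply: contra xO => /forallP h.
  by rewrite inE => j; rewrite !mxE; exact: h.
rewrite (bigD1 j)//= patchE ifF ?mul0r//.
by apply/negbTE; rewrite notin_setE /= in_itv/= andbT; apply/negP.
Qed.

Lemma exp_measureT d (c : 'cV[R]_d) : ltv 0 c -> exp_measure c setT = 1%E.
Proof.
move=> hc; rewrite /exp_measure.
under eq_integral do rewrite exp_densityE//.
have mcont (j : 'I_d) : measurable_fun setT (fun t : R => c j 0 * expR (- c j 0 * t)).
  apply: (@measurable_funM _ _ _ _ (cst (c j 0)) (fun t => expR (- c j 0 * t))) => //.
  apply: measurableT_comp => //.
have c0 j : 0 <= c j 0 by have := hc j; rewrite mxE => /ltW.
rewrite (@integral_lebesgue_tuple_prod d
  (fun j => ((fun t => c j 0 * expR (- c j 0 * t)) \_ `]0, +oo[))).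
- apply: big1 => j _; rewrite -(@integral_exponential_pdf R (c j 0)).
    rewrite (_ : (fun x => _) = (EFin \o (fun t => c j 0 * expR (- c j 0 * t))) \_ `]0, +oo[);
      last by rewrite restrict_EFin.
    rewrite -integral_mkcond integral_itv_obnd_cbnd.
      by rewrite [LHS]integral_mkcond restrict_EFin.
    by apply/measurable_EFinP; apply: measurable_funTS.
  by have := hc j; rewrite mxE.
- move=> j; apply/(measurable_restrictT _ (measurable_itv `]0%R, +oo[)).
  exact: measurable_funTS.
- by move=> j x; apply: restrict_ge0 => t _; rewrite mulr_ge0 ?expR_ge0.
Qed.

End exp_measureT.

(* Main.v *)
From HB Require Import structures.
Require Import Defs.
From mathcomp Require Import all_boot all_order all_algebra.
From mathcomp Require Import all_classical all_reals all_analysis.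
From mathcomp Require Import measurable_realfun ring lra.
Import Order.TTheory GRing.Theory Num.Theory.
Import numFieldNormedType.Exports.
Local Open Scope classical_set_scope.
Local Open Scope ring_scope.

(** The exponential laws on the positive orthant form an exponential family
    whose log-partition function is, up to sign, the log-barrier, so the entropy problem and
    the barrier problem are dual to each other.

    For [l] with [A^T l < c] put [b = c - A^T l > 0] and let [P_b] be the product
    of exponential laws of rates [b_j], so that [P = P_c].  On the orthant
    [ln (p_b / p_c) (x) = sum_j ln b_j - ln s + <l, A x>] depends on [x] through
    [A x] only.  Hence, for every competitor [Q] with [E_Q (A x) = y / eps],
    Gibbs' inequality (a consequence of [ln u <= u - 1], lemma [KL_ge]) gives
    [KL (Q, P) >= sum_j ln b_j - ln s + <l, y / eps>], with equality for
    [Q = P_b] as soon as [P_b] has the right mean.  The mean of [P_b] is the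
    vector [1 / b_j], so this requires [A (eps / b) = y], which is exactly the
    stationarity condition for the barrier function
    [<l, y> + eps * sum_j ln b_j].

    A stationary point exists because [y] is interior to the cone: then
    [y = A x] for some [x > 0], and the barrier function becomes
    [<c, x> + sum_j (eps ln b_j - x_j b_j)], whose summands tend to minus
    infinity when [b_j] tends to 0 or to infinity.  Its superlevel sets are thus
    compact in [b], hence in [l] as [A] has full row rank ([barrier_max],
    [barrier_stationary]).  This yields the formula for every [eps > 0].

    For the limit, let [l_r] be the maximiser for [eps = r].  The point
    [x_r = r / b] is feasible for the primal linear program and
    [<c, x_r> = <l_r, y> + d r]: the duality gap on the central path.  Since
    [c > 0], the [x_r] stay bounded, so the barrier value is at least
    [<c, x_r> + r O(|ln r|)], hence at least [tau y - o(1)] (lemma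
    [barrier_center_ge]).  Conversely every strictly positive feasible [x] bounds
    it by [<c, x> + o(1)] (lemma [barrier_le]), and such [x] can be chosen with
    cost close to [tau y] (lemma [barrier_center_cvg]). *)

Set Implicit Arguments.
Unset Strict Implicit.
Unset Printing Implicit Defensive.

(** * Pairing, slack and logarithm bounds *)

Lemma continuous_at_sum {R : realType} {T : topologicalType} (t : T)
    n (f : 'I_n -> T -> R) :
  (forall j, {for t, continuous (f j)}) ->
  {for t, continuous (fun x => \sum_j f j x)}.
Proof.
move=> fa; apply: cvg_big; [exact: (@add_continuous R^o)|by move=> i _; exact: fa].
Qed.

Lemma continuous_entry {R : realType} n (i : 'I_n) :
  continuous (fun v : 'rV[R]_n => v^T i 0).
Proof. by under eq_fun do rewrite mxE; exact: coord_continuous. Qed.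

Section dotp_theory.
Context {R : realType}.

Lemma dotp_trmx m d (A : 'M[R]_(m, d)) (l : 'cV[R]_m) (x : 'cV[R]_d) :
  dotp (A^T *m l) x = dotp l (A *m x).
Proof.
rewrite /dotp.
under eq_bigr do rewrite mxE mulr_suml.
rewrite exchange_big/=; apply: eq_bigr => i _.
rewrite mxE mulr_sumr; apply: eq_bigr => j _.
by rewrite mxE mulrCA mulrA.
Qed.

Lemma dotpBl n (u v x : 'cV[R]_n) : dotp (u - v) x = dotp u x - dotp v x.
Proof.
by rewrite /dotp -sumrB; apply: eq_bigr => j _; rewrite !mxE mulrBl.
Qed.

Lemma dotpDl n (u v x : 'cV[R]_n) : dotp (u + v) x = dotp u x + dotp v x.
Proof.
by rewrite /dotp -big_split/=; apply: eq_bigr => j _; rewrite !mxE mulrDl.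
Qed.

Lemma dotpZl n a (u x : 'cV[R]_n) : dotp (a *: u) x = a * dotp u x.
Proof.
by rewrite /dotp mulr_sumr; apply: eq_bigr => j _; rewrite !mxE mulrA.
Qed.

Lemma dotpDr n (x u v : 'cV[R]_n) : dotp x (u + v) = dotp x u + dotp x v.
Proof.
by rewrite /dotp -big_split/=; apply: eq_bigr => j _; rewrite !mxE mulrDr.
Qed.

Lemma dotpZr n (x u : 'cV[R]_n) a : dotp x (a *: u) = a * dotp x u.
Proof.
by rewrite /dotp mulr_sumr; apply: eq_bigr => j _; rewrite !mxE mulrCA.
Qed.

Lemma continuous_dotp n (c : 'cV[R]_n) : continuous (fun v : 'rV[R]_n => dotp c v^T).
Proof.
rewrite /dotp => v; apply: continuous_at_sum => j; apply: continuousM; first exact: cst_continuous.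
exact: continuous_entry.
Qed.

End dotp_theory.

Section log_bounds.
Context {R : realType}.
Implicit Types x e b : R.

Lemma ln_le_subr1 x : 0 < x -> ln x <= x - 1.
Proof. by move=> x0; have := @le_ln1Dx R (x - 1); rewrite subrKC; apply; lra. Qed.

(** The concave function [b |-> e ln b - x b] is maximal at [b = e / x]. *)
Lemma log_linear_le e x b : 0 < e -> 0 < x -> 0 < b ->
  e * ln b - x * b <= e * (ln (e / x) - 1).
Proof.
move=> e0 x0 b0.
have -> : ln b = ln (x * b / e) + ln (e / x).
  rewrite -lnM ?posrE ?divr_gt0 ?mulr_gt0//; congr ln; field.
  by rewrite !gt_eqF.
have := @ln_le_subr1 (x * b / e); rewrite !divr_gt0 ?mulr_gt0// => /(_ isT).
rewrite -(ler_pM2l e0) => h.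
have E : e * (x * b / e) = x * b by field; rewrite gt_eqF.
by move: h; rewrite !mulrDr !mulrN E; lra.
Qed.

(** Coercivity at both ends: near 0 the logarithm wins, at infinity the linear
    term does. *)
Lemma log_linear_superlevel e x L : 0 < e -> 0 < x ->
  exists lo hi : R, 0 < lo /\
    forall b, 0 < b -> L <= e * ln b - x * b -> lo <= b <= hi.
Proof.
move=> e0 x0.
(* Half of the slope absorbs the logarithm; the other half then bounds [b]. *)
exists (expR (L / e)), (2 * (e * (ln (e / (x / 2)) - 1) - L) / x).
split; first exact: expR_gt0.
move=> b b0 Lb; apply/andP; split.
  rewrite -[b]lnK// ler_expR ler_pdivrMr// mulrC (le_trans Lb)//.
  by have := mulr_gt0 x0 b0; lra.
rewrite ler_pdivlMr//.
have x20 : 0 < x / 2 by rewrite divr_gt0.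
by have := log_linear_le e0 x20 b0; lra.
Qed.

End log_bounds.

(** * The log-barrier problem *)

Section barrier.
Context {R : realType} {m d : nat}.
Variables (A : 'M[R]_(m, d)) (c : 'cV[R]_d).
Implicit Types (y l : 'cV[R]_m) (x : 'cV[R]_d) (e : R).

Definition slack l : 'cV[R]_d := c - A^T *m l.

Definition barrier y e l : R := dotp l y + e * \sum_j ln (slack l j 0).

Lemma slackE l j : slack l j 0 = c j 0 - (A^T *m l) j 0.
Proof. by rewrite mxE [X in _ + X]mxE. Qed.

Lemma slack_gt0 l : ltv (A^T *m l) c <-> forall j, 0 < slack l j 0.
Proof.
by split => h j; have := h j; rewrite slackE subr_gt0.
Qed.

Lemma dotp_slack l x : dotp l (A *m x) = dotp c x - dotp (slack l) x.
Proof. by rewrite /slack dotpBl dotp_trmx subKr. Qed.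

(** Any solution [x] of [A x = y] separates the barrier function into functions
    of one slack each. *)
Lemma barrier_feasible y e l x : A *m x = y ->
  barrier y e l = dotp c x + \sum_j (e * ln (slack l j 0) - x j 0 * slack l j 0).
Proof.
move=> <-; rewrite /barrier dotp_slack -addrA; congr (_ + _).
rewrite sumrB mulr_sumr addrC; congr (_ - _); apply: eq_bigr => j _.
by rewrite mulrC.
Qed.

(** Weak duality between the primal and the dual barrier problems. *)
Lemma barrier_le y e l x : 0 < e -> ltv (A^T *m l) c -> ltv 0 x -> A *m x = y ->
  barrier y e l <= dotp c x + e * \sum_j (ln (e / x j 0) - 1).
Proof.
move=> e0 /slack_gt0 lc x0 /barrier_feasible ->; rewrite lerD2l mulr_sumr.
by apply: ler_sum => j _; apply: log_linear_le => //; have := x0 j; rewrite mxE.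
Qed.

(** An interior point can be moved by a small multiple of [- A 1] without leaving
    the cone; adding that multiple of the all-ones vector back makes its preimage
    strictly positive. *)
Lemma interior_cone_pos y : interior (cone A) y ->
  exists2 x, ltv 0 x & A *m x = y.
Proof.
move=> yA; pose u : 'cV[R]_d := const_mx 1.
have cvg0 : (fun t : R => y - t *: (A *m u)) @ (0 : R) --> y.
  rewrite -[X in _ --> X]subr0; apply: cvgB; first exact: cvg_cst.
  rewrite -(scale0r (A *m u)); apply: cvgZr_tmp; exact: cvg_id.
have : \forall t \near (0:R), cone A (y - t *: (A *m u)).
  exact: cvg0.
move=> /nbhs_ballP[e /= e0 /(_ (e / 2))] []; last move=> z /= z0 Az.
  by rewrite /ball/= sub0r normrN gtr0_norm ?divr_gt0//; lra.
exists (z + (e / 2) *: u); last by rewrite mulmxDr -scalemxAr Az subrK.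
by move=> j; have := z0 j; rewrite !mxE; lra.
Qed.

Lemma continuous_slack j : continuous (fun v : 'rV[R]_m => slack v^T j 0).
Proof.
under eq_fun do rewrite slackE mxE.
move=> v; apply: continuousB; first exact: cst_continuous.
apply: continuous_at_sum => i; apply: continuousM; first exact: cst_continuous.
exact: continuous_entry.
Qed.

Lemma closed_slack_box (lo hi : 'I_d -> R) :
  closed [set v : 'rV[R]_m | forall j, lo j <= slack v^T j 0 <= hi j].
Proof.
rewrite (_ : mkset _ = \bigcap_(j in [set: 'I_d])
    ((fun v : 'rV[R]_m => slack v^T j 0) @^-1` `[lo j, hi j]%classic)); last first.
  apply/seteqP; split => v /= h.
    by move=> j _; rewrite /= in_itv/=; exact: h.
  by move=> j; have := h j I; rewrite /= in_itv/=.
apply: closed_bigI => j _; apply: preimage_closed; last exact: interval_closed.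
by move=> v _; exact: continuous_slack.
Qed.

Hypothesis hA : row_free A.

(** Full row rank makes [l] a linear function of its slack: [A] has the right
    inverse [pinvmx A]. *)
Lemma bounded_slack_box (lo hi : 'I_d -> R) :
  bounded_set [set v : 'rV[R]_m | forall j, lo j <= slack v^T j 0 <= hi j].
Proof.
pose P := pinvmx A.
pose M := \sum_i \sum_j (`|c j 0| + `|lo j| + `|hi j|) * `|P j i|.
exists M; split; first exact: num_real.
move=> r Mr v /= vb; apply: le_trans (ltW Mr).
have v_E : v = (c - slack v^T)^T *m P.
  by rewrite /slack subKr trmx_mul !trmxK -mulmxA mulmxVp ?mulmx1.
rewrite [leLHS]/Num.norm/= mx_normrE; apply/bigmax_leP => /=; split.
  by apply: sumr_ge0 => i _; apply: sumr_ge0 => j _; rewrite mulr_ge0 ?addr_ge0.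
move=> [i0 i] _ /=; rewrite ord1 {1}v_E mxE.
apply: (le_trans (ler_norm_sum _ _ _)).
rewrite /M (bigD1 i)//= -[leLHS]addr0; apply: lerD; last first.
  by apply: sumr_ge0 => i1 _; apply: sumr_ge0 => j _; rewrite mulr_ge0 ?addr_ge0.
apply: ler_sum => j _; rewrite normrM ler_wpM2r//.
have -> : (c - slack v^T)^T 0 j = c j 0 - slack v^T j 0.
  by rewrite mxE mxE; congr (_ + _); rewrite mxE.
rewrite (le_trans (ler_normB _ _))// -addrA lerD2l.
have /andP[h1 h2] := vb j; rewrite ler_norml.
have := ler_norm (hi j); have := lerNnormlW (lexx `|lo j|).
by have := normr_ge0 (lo j); have := normr_ge0 (hi j); lra.
Qed.

(** Compactness of superlevel sets: as each separated term is bounded above, a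
    lower bound on their sum confines every slack to a compact interval of
    positive numbers. *)
Lemma barrier_max y e l0 : 0 < e -> interior (cone A) y -> ltv (A^T *m l0) c ->
  exists2 l, ltv (A^T *m l) c &
    forall l', ltv (A^T *m l') c -> barrier y e l' <= barrier y e l.
Proof.
move=> e0 /interior_cone_pos[x x0 Axy] l0c.
have {}x0 j : 0 < x j 0 by have := x0 j; rewrite mxE.
pose M j := e * (ln (e / x j 0) - 1).
(* What term [j] is forced to reach when all the others are at most [M]. *)
pose L j := barrier y e l0 - dotp c x - \sum_(k | k != j) M k.
have /choice[lo] j := log_linear_superlevel (L j) e0 (x0 j).
move=> /choice[hi lohi].
pose K := [set v : 'rV[R]_m | forall j, lo j <= slack v^T j 0 <= hi j].
have KP l : ltv (A^T *m l) c -> barrier y e l0 <= barrier y e l -> K l^T.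
  move=> /slack_gt0 l_gt0 l0l j; rewrite trmxK; apply: (lohi j).2 => //.
  move: l0l; rewrite (barrier_feasible e l Axy) (bigD1 j)//= /L.
  suff : \sum_(k < d | k != j) (e * ln (slack l k 0) - x k 0 * slack l k 0)
         <= \sum_(k | k != j) M k by lra.
  by apply: ler_sum => k _; exact: log_linear_le.
have K_gt0 v : K v -> forall j, 0 < slack v^T j 0.
  by move=> Kv j; have /andP[+ _] := Kv j; apply: lt_le_trans; exact: (lohi j).1.
have [|||v /set_mem Kv vmax] := @compact_EVT_max _ R (fun v => barrier y e v^T) K.
- by exists l0^T; exact: KP.
- by apply: bounded_closed_compact;
    [exact: bounded_slack_box|exact: closed_slack_box].
- apply: continuous_in_subspaceT => v /set_mem Kv.
  have -> : (fun v : 'rV[R]_m => barrier y e v^T) =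
      (fun v => dotp v^T y) \+ (fun v => e * \sum_j ln (slack v^T j 0)) by [].
  apply: continuousD.
    apply: continuous_at_sum => i; apply: continuousM; last exact: cst_continuous.
    exact: continuous_entry.
  apply: continuousM; first exact: cst_continuous.
  apply: continuous_at_sum => j.
  by apply: continuous_comp;
    [exact: continuous_slack|apply: continuous_ln; exact: K_gt0].
exists v^T; first exact/slack_gt0/K_gt0.
move=> l lc.
have [/(KP _ lc) Kl|/ltW h] := lerP (barrier y e l0) (barrier y e l).
  by have := vmax _ (mem_set Kl); rewrite trmxK.
apply: (le_trans h); have := vmax l0^T; rewrite trmxK; apply.
by apply/mem_set/KP.
Qed.

(** The first order condition. The point [e / slack] it produces is at once the
    primal point of the central path and, up to the factor [e], the mean of the
    optimal exponential law. *)
Lemma barrier_stationary y e l : ltv (A^T *m l) c ->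
  (forall l', ltv (A^T *m l') c -> barrier y e l' <= barrier y e l) ->
  A *m (\col_j (e / slack l j 0)) = y.
Proof.
move=> /slack_gt0 s0 lmax; set x := \col_j _.
(* A maximum along every line gives equality against every direction [u]; the
   direction [y - A x] itself concludes. *)
suff dotp_eq u : dotp u y = dotp u (A *m x).
  apply/esym/eqP; rewrite -subr_eq0; apply/eqP; set z := y - A *m x.
  have : dotp z z = 0.
    by rewrite {2}/z dotpDr -scaleN1r dotpZr mulN1r dotp_eq subrr.
  move/eqP; rewrite /dotp psumr_eq0 => [/allP z0|i _]; last exact: sqr_ge0.
  apply/matrixP => i k; rewrite (ord1 k) [RHS]mxE; apply/eqP.
  by have := z0 i (mem_index_enum _); rewrite mulf_eq0 orbb.
pose a := A^T *m u.
have slackD t j : slack (l + t *: u) j 0 = slack l j 0 - t * a j 0.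
  by rewrite !slackE mulmxDr -scalemxAr mxE [X in _ - (_ + X)]mxE opprD addrA.
have [r r0 sr] : exists2 r : R, 0 < r &
    forall t, t \in `]- r, r[ -> forall j, 0 < slack l j 0 - t * a j 0.
  have : \forall t \near (0 : R), forall j, 0 < slack l j 0 - t * a j 0.
    apply: (@filter_forall _ _ (fun j t => 0 < slack l j 0 - t * a j 0)
      _ (nbhs_filter (0 : R))) => j.
    have : (fun t => slack l j 0 - t * a j 0) @ (0 : R) --> slack l j 0.
      rewrite -[X in _ --> X]subr0 -[X in _ --> _ - X](mul0r (a j 0)).
      by apply: cvgB; [exact: cvg_cst|apply: cvgMr_tmp; exact: cvg_id].
    by move=> sj; exact: (cvgr_gt _ sj _ (s0 j)).
  move=> /nbhs_ballP[r /= r0 hr]; exists r => // t; rewrite in_itv/= => tr.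
  by apply: hr; rewrite /ball/= sub0r normrN ltr_norml.
pose h t := barrier y e (l + t *: u).
have hE : h = cst (dotp l y) + (fun t => t * dotp u y)
    + cst e * \sum_j (fun t => ln (slack l j 0 - t * a j 0)).
  apply/funext => t; rewrite /h /barrier !fctE fct_sumE/=; congr (_ + e * _).
    by rewrite -[in RHS](dotpZl t) -dotpDl.
  by apply: eq_bigr => j _; rewrite slackD.
have dh t : t \in `]- r, r[ -> is_derive t 1 h
    (dotp u y + e * \sum_j (- a j 0) / (slack l j 0 - t * a j 0)).
  move=> /sr tr; rewrite hE.
  have dln j : is_derive t 1 (fun t => ln (slack l j 0 - t * a j 0))
      (- a j 0 / (slack l j 0 - t * a j 0)).
    have dlin : is_derive t 1 (cst (slack l j 0) - a j 0 \*: id) (- a j 0).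
      by apply: is_derive_eq; rewrite sub0r scaler1.
    rewrite (_ : (fun t => _) = @ln R \o (cst (slack l j 0) - a j 0 \*: id)); last first.
      by apply/funext => t'/=; rewrite !fctE mulrC.
    rewrite mulrC; apply: is_derive1_comp.
    have E : (cst (slack l j 0) - a j 0 \*: id) t = slack l j 0 - t * a j 0.
      by rewrite !fctE mulrC.
    by rewrite -E; apply: is_derive1_ln; rewrite E.
  pose S := \sum_j (fun t => ln (slack l j 0 - t * a j 0)).
  have -> : cst (dotp l y) + *%R^~ (dotp u y) + cst e * S =
      cst (dotp l y) + dotp u y \*: id + e \*: S.
    by apply/funext => t'; rewrite !fctE mulrC.
  have dS := is_derive_sum dln.
  by apply: is_derive_eq; rewrite add0r scaler1.
have rr : - r <= r by lra.
have r00 : 0 \in `]- r, r[ by rewrite in_itv/=; lra.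
have hmax t : t \in `]- r, r[ -> h t <= h 0.
  move=> /sr tr; rewrite {2}/h scale0r addr0; apply: lmax; apply/slack_gt0 => j.
  by rewrite slackD.
have d0 := derive1_at_max rr (fun t tr => @ex_derive _ _ _ _ _ _ _ (dh t tr)) r00 hmax.
have := @derive_val _ _ _ _ _ _ _ (dh 0 r00).
rewrite (@derive_val _ _ _ _ _ _ _ d0) => /eqP; rewrite eq_sym addrC addr_eq0 => /eqP uy.
rewrite -dotp_trmx -/a; apply: oppr_inj; rewrite -uy mulr_sumr /dotp -sumrN.
by apply: eq_bigr => j _; rewrite mul0r subr0 [x j 0]mxE mulNr mulrN mulrCA.
Qed.

End barrier.

(** * The primal linear program *)

Section lp.
Context {R : realType} {m d : nat}.
Variables (A : 'M[R]_(m, d)) (c : 'cV[R]_d).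
Hypothesis hc : ltv 0 c.

Let c_gt0 j : 0 < c j 0. Proof. by have := hc j; rewrite mxE. Qed.

Lemma entry_le_dotp x j : lev 0 x -> x j 0 <= dotp c x / c j 0.
Proof.
move=> x0; rewrite ler_pdivlMr// mulrC /dotp (bigD1 j)//= lerDl.
apply: sumr_ge0 => k _; rewrite mulr_ge0//; last by have := x0 k; rewrite mxE.
exact/ltW/c_gt0.
Qed.

Lemma continuous_mulmx_entry i : continuous (fun v : 'rV[R]_d => (A *m v^T) i 0).
Proof.
under eq_fun do rewrite mxE.
move=> v; apply: continuous_at_sum => j.
by apply: continuousM; [exact: cst_continuous|exact: continuous_entry].
Qed.

(** Positivity of [c] makes the sublevel sets of the cost compact on the
    feasible set. *)
Lemma lp_min y : lp_feasible A y !=set0 ->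
  exists2 x, lp_feasible A y x &
    forall x', lp_feasible A y x' -> dotp c x <= dotp c x'.
Proof.
move=> [x1 x1y].
pose K := [set v : 'rV[R]_d | (forall j, `[0, dotp c x1 / c j 0]%classic (v ord0 j))]
  `&` \bigcap_(i in [set: 'I_m]) ((fun v : 'rV[R]_d => (A *m v^T) i 0) @^-1` [set y i 0]).
have KP x : lp_feasible A y x -> dotp c x <= dotp c x1 -> K x^T.
  move=> [x0 Ax] xx1; split => [j|i _] /=; last by rewrite trmxK Ax.
  have := x0 j; rewrite in_itv/= !mxE => ->/=.
  by rewrite (le_trans (entry_le_dotp j x0))// ler_pM2r ?invr_gt0.
have [|||v /set_mem Kv vmin] := @compact_EVT_min _ R (fun v => dotp c v^T) K.
- by exists x1^T; exact: KP.
- apply: (@subclosed_compact _ K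
    [set v : 'rV[R]_d | forall j, `[0, dotp c x1 / c j 0]%classic (v ord0 j)]).
  + apply: closedI.
      rewrite (_ : mkset _ = \bigcap_(j in [set: 'I_d])
        ((fun v : 'rV[R]_d => v^T j 0) @^-1` `[0, dotp c x1 / c j 0]%classic)).
        apply: closed_bigI => j _; apply: preimage_closed; last exact: interval_closed.
        by move=> v _; exact: continuous_entry.
      apply/seteqP; split => v /= h; first by move=> j _; rewrite /= mxE; exact: h.
      by move=> j; have := h j I; rewrite /= mxE.
    apply: closed_bigI => i _; apply: preimage_closed; last exact: closed_eq.
    by move=> v _; exact: continuous_mulmx_entry.
  + apply: (@rV_compact _ _ (fun j => `[0, dotp c x1 / c j 0]%classic)) => j.
    exact: segment_compact.
  + by move=> v [].
- by apply: continuous_in_subspaceT => v _; exact: continuous_dotp.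
have vy : lp_feasible A y v^T.
  split => [j|]; first by have := Kv.1 j; rewrite /= in_itv/= => /andP[+ _]; rewrite !mxE.
  by apply/matrixP => i k; rewrite (ord1 k); exact: Kv.2.
exists v^T => // x xy.
have [xx1|/ltW x1x] := lerP (dotp c x) (dotp c x1).
  by have := vmin _ (mem_set (KP _ xy xx1)); rewrite trmxK.
apply: le_trans x1x; have := vmin x1^T; rewrite trmxK; apply.
by apply/mem_set/KP.
Qed.

End lp.

(** * The limit along the central path *)

Section log_errors.
Context {R : realType}.

(** Squeezed by [- 2 sqrt r], from [ln u < u] at [u = 1 / sqrt r]. *)
Lemma cvg_mul_ln : (r * ln r) @[r --> (0 : R)^'+] --> (0 : R).
Proof.
have sq0 : - (2 * Num.sqrt r) @[r --> (0 : R)^'+] --> (0 : R).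
  rewrite [X in _ --> X](_ : 0 = - (2 * Num.sqrt 0)); last first.
    by rewrite sqrtr0 mulr0 oppr0.
  apply: cvgN; apply: cvgMl_tmp; apply: cvg_at_right_filter; exact: sqrt_continuous.
apply: (@squeeze_cvgr _ _ _ _ (fun r => - (2 * Num.sqrt r)) (cst 0)) => //; last exact: cvg_cst.
near=> r.
have r0 : 0 < r by near: r; exact: nbhs_right_gt.
have r1 : r <= 1 by near: r; apply: nbhs_right_le.
rewrite /=; apply/andP; split; last by rewrite pmulr_rle0// ln_le0.
have s0 : 0 < Num.sqrt r by rewrite sqrtr_gt0.
rewrite -[X in X * ln _](sqr_sqrtr (ltW r0)) -[X in ln X](sqr_sqrtr (ltW r0)).
rewrite lnXn// -[ln _]opprK -lnV//.
have := @ln_sublinear _ (Num.sqrt r)^-1; rewrite invr_gt0 => /(_ s0) /ltW.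
rewrite -(ler_pM2l s0) divff ?gt_eqF// => h.
by have := ler_wpM2l (ltW s0) h; lra.
Unshelve. all: by end_near. Qed.

Lemma cvg_mul_sum_ln n (k : 'I_n -> R) :
  (r * \sum_j (ln r - k j)) @[r --> (0 : R)^'+] --> (0 : R).
Proof.
rewrite [X in _ --> X](_ : 0 = 0 *+ n - 0 * \sum_j k j); last first.
  by rewrite mul0rn mul0r subr0.
under eq_fun do rewrite sumrB sumr_const card_ord mulrBr mulrnAr.
apply: cvgB; first by apply: cvgMn; exact: cvg_mul_ln.
by apply: cvgMr_tmp; apply: cvg_at_right_filter; exact: cvg_id.
Qed.

End log_errors.

Section small_parameter.
Context {R : realType} {m d : nat}.
Variables (A : 'M[R]_(m, d)) (c : 'cV[R]_d) (y : 'cV[R]_m).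
Hypothesis hc : ltv 0 c.

Let c_gt0 j : 0 < c j 0. Proof. by have := hc j; rewrite mxE. Qed.

(** At a stationary point the gap between the cost of [z = r / slack] and the
    dual objective is [d * r]. As the dual objective is at most the cost of a fixed
    feasible [x'], this bounds [z], hence keeps the slacks [r / z] from being much
    smaller than [r]. *)
Lemma barrier_center_ge x x' r l :
  lp_feasible A y x' -> (forall z, lp_feasible A y z -> dotp c x <= dotp c z) ->
  0 < r <= 1 -> ltv (A^T *m l) c -> A *m (\col_j (r / slack A c l j 0)) = y ->
  dotp c x + r * \sum_j (ln r - (1 + ln ((dotp c x' + d%:R) / c j 0)))
  <= barrier A c y r l.
Proof.
move=> [x'0 Ax'] xmin /andP[r0 r1] /slack_gt0 s0; set z := \col_j _ => Az.
have zE j : z j 0 = r / slack A c l j 0 by rewrite mxE.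
have z0 j : 0 < z j 0 by rewrite zE divr_gt0.
have zs j : z j 0 * slack A c l j 0 = r by rewrite zE divfK// gt_eqF.
have zfeas : lp_feasible A y z by split => // j; rewrite mxE ltW.
have gap : dotp c z = dotp l y + d%:R * r.
  rewrite -Az (dotp_slack A c) [X in _ - X + _](_ : _ = d%:R * r) ?subrK//.
  rewrite /dotp; under eq_bigr do rewrite mulrC zs.
  by rewrite sumr_const card_ord mulr_natl.
have ly : dotp l y <= dotp c x'.
  rewrite -Ax' (dotp_slack A c) lerBlDr lerDl; apply: sumr_ge0 => j _.
  by rewrite mulr_ge0 ?(ltW (s0 j))//; have := x'0 j; rewrite mxE.
rewrite (barrier_feasible c r l Az); apply: lerD; first exact: xmin.
rewrite mulr_sumr; apply: ler_sum => j _; rewrite zs.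
have -> : slack A c l j 0 = r / z j 0 by rewrite zE invf_div mulrCA divff ?mulr1 ?gt_eqF.
rewrite [ln (r / _)]ln_div ?posrE//.
suff /(ler_wpM2l (ltW r0)) : ln (z j 0) <= ln ((dotp c x' + d%:R) / c j 0).
  by rewrite !mulrBr !mulrDr mulr1; lra.
have zle : z j 0 <= (dotp c x' + d%:R) / c j 0.
  apply: (le_trans (entry_le_dotp hc j zfeas.1)).
  by rewrite ler_pM2r ?invr_gt0// gap lerD// ler_piMr.
by rewrite ler_ln ?posrE// (lt_le_trans (z0 j)).
Qed.

Lemma barrier_center_cvg x (G : R -> R) :
  interior (cone A) y ->
  lp_feasible A y x -> (forall z, lp_feasible A y z -> dotp c x <= dotp c z) ->
  (forall r, 0 < r -> exists l, [/\ ltv (A^T *m l) c,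
     A *m (\col_j (r / slack A c l j 0)) = y & G r = barrier A c y r l]) ->
  G r @[r --> 0^'+] --> dotp c x.
Proof.
move=> /interior_cone_pos[x' x'0 Ax'] [x0 Ax] xmin Gcenter.
have x'feas : lp_feasible A y x' by split => // j; exact/ltW.
apply/cvgrPdist_lt => e e0.
pose D := dotp c x' - dotp c x.
have D0 : 0 <= D by rewrite subr_ge0; exact: xmin.
(* Moving the minimiser by the fraction [t] towards the strictly positive [x']
   costs at most [e / 2]. *)
pose t := e / 2 / (D + e).
have De0 : 0 < D + e by lra.
have t0 : 0 < t by rewrite !divr_gt0.
have t1 : t < 1 by rewrite ltr_pdivrMr//; lra.
have tD : t * D <= e / 2.
  by rewrite /t mulrAC ler_pdivrMr// ler_pM2l ?divr_gt0//; lra.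
pose xt := (1 - t) *: x + t *: x'.
have xt0 : ltv 0 xt.
  move=> j; have := x0 j; have := x'0 j; rewrite !mxE => h1 h2.
  have := mulr_gt0 t0 h1; have : 0 <= (1 - t) * x j 0 by rewrite mulr_ge0//; lra.
  lra.
have Axt : A *m xt = y.
  by rewrite mulmxDr -!scalemxAr Ax Ax' -scalerDl subrK scale1r.
have cxt : dotp c xt = dotp c x + t * D by rewrite dotpDr !dotpZr /D; ring.
have /cvgrPdist_lt/(_ (e / 2)) up :=
  @cvg_mul_sum_ln R d (fun j => 1 + ln (xt j 0)).
have /cvgrPdist_lt/(_ (e / 2)) low :=
  @cvg_mul_sum_ln R d (fun j => 1 + ln ((dotp c x' + d%:R) / c j 0)).
have e20 : 0 < e / 2 by rewrite divr_gt0.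
near=> r.
have r0 : 0 < r by near: r; exact: nbhs_right_gt.
have r1 : r <= 1 by near: r; exact: nbhs_right_le.
have [l [lc Al ->]] := Gcenter _ r0.
have h1 := barrier_le r0 lc xt0 Axt.
have r01 : 0 < r <= 1 by rewrite r0.
have h2 := barrier_center_ge x'feas xmin r01 lc Al.
have {h1} : barrier A c y r l <= dotp c x + t * D
    + r * \sum_j (ln r - (1 + ln (xt j 0))).
  rewrite -cxt; congr (_ <= _ + r * _) : h1; apply: eq_bigr => j _.
  by rewrite ln_div ?posrE//; [ring|have := xt0 j; rewrite mxE].
move: h2.
have : `|0 - r * \sum_j (ln r - (1 + ln (xt j 0)))| < e / 2 by near: r; exact: up.
have : `|0 - r * \sum_j (ln r - (1 + ln ((dotp c x' + d%:R) / c j 0)))| < e / 2.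
  by near: r; exact: low.
rewrite !ltr_norml => /andP[? ?] /andP[? ?] ? ?; apply/andP; split; lra.
Unshelve. all: by end_near. Qed.

End small_parameter.

(** * Integration against a measure with a density *)

Section density.
Local Open Scope ereal_scope.
Context d (T : measurableType d) (R : realType).
Variables (Q : {finite_measure set T -> \bar R})
          (mu : {sigma_finite_measure set T -> \bar R}) (q : T -> R).
Hypothesis mq : measurable_fun setT q.
Hypothesis q0 : forall x, (0 <= q x)%R.
Hypothesis Qq : forall B, measurable B -> Q B = \int[mu]_(x in B) (q x)%:E.

Let Q_dom : Q `<< mu.
Proof.
move=> N N0 B mB BN; rewrite Qq// null_set_integral//; last exact: N0.
exact/measurable_EFinP/measurable_funTS.
Qed.

(** Transfers the change of variables known for the Radon-Nikodym derivative to
    an arbitrary density. *)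
Let deriv_ae_eq : ae_eq mu setT (Radon_Nikodym_SigmaFinite.f Q mu) (EFin \o q).
Proof.
apply: integral_ae_eq => //; first exact: Radon_Nikodym_SigmaFinite.f_integrable.
  exact/measurable_EFinP.
by move=> E _ mE; rewrite -Radon_Nikodym_SigmaFinite.f_integral// Qq.
Qed.

Lemma ge0_integral_density f E : measurable E -> measurable_fun E f ->
  (forall x, 0 <= f x) ->
  \int[Q]_(x in E) f x = \int[mu]_(x in E) (f x * (q x)%:E).
Proof.
move=> mE mf f0; rewrite -(Radon_Nikodym_SigmaFinite.change_of_variables Q_dom)//.
apply: ge0_ae_eq_integral => //.
- apply: emeasurable_funM => //; apply: measurable_funTS.
  exact: (measurable_int mu (Radon_Nikodym_SigmaFinite.f_integrable Q_dom)).
- by apply: emeasurable_funM => //; exact/measurable_EFinP/measurable_funTS.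
- by move=> x _; rewrite mule_ge0// Radon_Nikodym_SigmaFinite.f_ge0.
- by move=> x _; rewrite mule_ge0// lee_fin.
- apply: ae_eqe_mul2l; exact: (ae_eq_subset _ deriv_ae_eq).
Qed.

Lemma integrable_density f E : measurable E -> Q.-integrable E f ->
  mu.-integrable E (fun x => f x * (q x)%:E).
Proof.
move=> mE /integrableP[mf fy]; apply/integrableP; split.
  by apply: emeasurable_funM => //; exact/measurable_EFinP/measurable_funTS.
under eq_integral do rewrite abseM (@gee0_abs _ (q _)%:E) ?lee_fin//.
by rewrite -ge0_integral_density//; exact: measurableT_comp.
Qed.

Lemma integral_density f E : measurable E -> measurable_fun E f ->
  \int[Q]_(x in E) f x = \int[mu]_(x in E) (f x * (q x)%:E).
Proof.
move=> mE mf; rewrite integralE [RHS]integralE.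
rewrite !ge0_integral_density//; [|exact: measurable_funeneg|exact: measurable_funepos].
congr (_ - _); apply: eq_integral => x _.
  by rewrite !funeposE maxe_pMl ?lee_fin// mul0e.
by rewrite !funenegE maxe_pMl ?lee_fin// mul0e mulNe.
Qed.

End density.

(** Only the minorant is integrable: the integral of [g] may be infinite, which
    is how it will be used for a divergence. *)
Lemma integrable_le_integral dd (T : measurableType dd) (R : realType)
    (mu : {measure set T -> \bar R}) (D : set T) (f g : T -> \bar R) :
  measurable D -> mu.-integrable D f -> measurable_fun D g ->
  (forall x, D x -> (f x <= g x)%E) ->
  (\int[mu]_(x in D) f x <= \int[mu]_(x in D) g x)%E.
Proof.
move=> mD /measurable_int mf mg fg.
rewrite integralE [leRHS]integralE; apply: leeB; apply: ge0_le_integral => //.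
- exact: measurable_funepos.
- exact: measurable_funepos.
- move=> x Dx; rewrite !funeposE; have := fg x Dx.
  by move=> h; rewrite ge_max !le_max h lexx orbT.
- exact: measurable_funeneg.
- exact: measurable_funeneg.
- move=> x Dx; rewrite !funenegE; have := fg x Dx.
  by move=> h; rewrite ge_max !le_max leeN2 h lexx orbT.
Qed.

(** * Products of exponential laws *)

Section exponential_line.
Context {R : realType}.
Notation mu := (@lebesgue_measure R).

Definition exp_pdf1 (r : R) : R -> R := (fun t => r * expR (- r * t)) \_ `]0, +oo[.

Let continuous_expM (r : R) : continuous (fun t : R => r * expR (- r * t)).
Proof.
move=> t; apply: cvgMl_tmp.
apply: (@continuous_comp _ _ _ (fun t => - r * t) expR); last exact: continuous_expR.
by apply: cvgMl_tmp; exact: cvg_id.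
Qed.

Lemma measurable_exp_pdf1 r : measurable_fun setT (exp_pdf1 r).
Proof.
apply/(measurable_restrictT _ (measurable_itv `]0%R, +oo[)); apply: measurable_funTS.
exact: continuous_measurable_fun.
Qed.

Lemma exp_pdf1_ge0 r t : 0 < r -> 0 <= exp_pdf1 r t.
Proof.
by move=> r0; apply: restrict_ge0 => u _; rewrite mulr_ge0 ?expR_ge0// ltW.
Qed.

Lemma integralM_exp_pdf1 r (h : R -> R) : measurable_fun setT h ->
  (\int[mu]_t (h t * exp_pdf1 r t)%:E =
   \int[mu]_(t in `[0%R, +oo[) (h t * (r * expR (- r * t)))%:E)%E.
Proof.
move=> mh; rewrite -integral_itv_obnd_cbnd; last first.
  apply/measurable_EFinP/measurable_funTS/measurable_funM => //.
  exact: continuous_measurable_fun.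
rewrite [RHS]integral_mkcond; apply: eq_integral => t _.
by rewrite /exp_pdf1 !patchE; case: ifPn => // _; rewrite mulr0.
Qed.

Lemma integral_exp_pdf1 r : 0 < r -> (\int[mu]_t (exp_pdf1 r t)%:E = 1)%E.
Proof.
move=> r0; rewrite -(integral_exponential_pdf r0).
have := @integralM_exp_pdf1 r (cst 1) (measurable_cst _).
under eq_integral do rewrite /= mul1r.
move=> ->; rewrite integral_mkcond; apply: eq_integral => t _.
by rewrite /exponential_pdf !patchE; case: ifPn => // _; rewrite mul1r.
Qed.

(** The quadratic term of the exponential series beats the factor [t]. *)
Lemma mul_expRN_cvg0 r : 0 < r -> t * expR (- r * t) @[t --> +oo] --> (0 : R).
Proof.
move=> r0.
have bnd : (2 / r ^+ 2) * t^-1 @[t --> +oo] --> (0 : R).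
  rewrite [X in _ --> X](_ : 0 = (2 / r ^+ 2) * 0); last by rewrite mulr0.
  apply: cvgMl_tmp; apply/gtr0_cvgV0; last exact: cvg_id.
  exact: nbhs_pinfty_gt.
apply: (@squeeze_cvgr _ _ _ _ (cst 0) (fun t => (2 / r ^+ 2) * t^-1)) => //; last exact: cvg_cst.
near=> t.
have t0 : 0 < t by near: t; exact: nbhs_pinfty_gt.
rewrite /=; apply/andP; split; first by rewrite mulr_ge0 ?expR_ge0// ltW.
have rt0 : 0 < r * t by rewrite mulr_gt0.
have := @expR_ge1Dxn R (r * t) 1 (ltW rt0); rewrite (_ : 2`!%:R = 2)// => h.
rewrite mulNr expRN ler_pdivrMr ?expR_gt0//.
rewrite [leLHS](_ : t = 2 / r ^+ 2 / t * ((r * t) ^+ 2 / 2)); last first.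
  by field; rewrite !gt_eqF.
rewrite ler_pM2l ?divr_gt0 ?exprn_gt0//; lra.
Unshelve. all: by end_near. Qed.

Lemma integral_id_exp_pdf1 r : 0 < r -> (\int[mu]_t (t * exp_pdf1 r t)%:E = r^-1%:E)%E.
Proof.
move=> r0; rewrite (@integralM_exp_pdf1 r id)//=.
(* An antiderivative of [t r exp (- r t)]. *)
pose F (t : R) : R := - ((t + r^-1) * expR (- r * t)).
have dF (t : R) : is_derive t 1 F (t * (r * expR (- r * t))).
  have -> : F = - ((id + cst r^-1) * (expR \o (- r \*: id))) by [].
  apply: is_derive_eq; rewrite !fctE.
  change (- ((t + r^-1) * (expR (- r * t) * (- r * 1)) + expR (- r * t) * (1 + 0))
    = t * (r * expR (- r * t))).
  by field; rewrite gt_eqF.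
have cF : continuous F.
  by move=> z; apply: differentiable_continuous; apply/derivable1_diffP; exact: ex_derive.
rewrite (@ge0_continuous_FTC2y _ _ F _ 0)//.
- by rewrite /F mulr0 expR0 mulr1 -EFinN opprK !add0r.
- by move=> t t0; rewrite !mulr_ge0 ?expR_ge0// ltW.
- apply: continuous_subspaceT => t; apply: cvgM; [exact: cvg_id|exact: continuous_expM].
- rewrite /F [X in _ --> X](_ : 0 = - (0 + r^-1 * 0)); last by rewrite mulr0 add0r oppr0.
  under eq_fun do rewrite mulrDl.
  apply: cvgN; apply: cvgD; first exact: mul_expRN_cvg0.
  apply: cvgMl_tmp; under eq_fun do rewrite mulNr.
  apply: (@cvg_comp _ _ _ _ (fun z : R => expR (- z)) _ (pinfty_nbhs R)); last exact: cvgr_expR.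
  exact: gt0_cvgMry.
- by apply: cvg_at_right_filter; exact: cF.
- by move=> t _; rewrite derive1E; exact: derive_val.
Qed.
End exponential_line.

Section product_exponential.
Context {R : realType} {d : nat}.
Variable b : 'cV[R]_d.
Hypothesis hb : ltv 0 b.
Notation mu := (lebesgue_tuple R d).

Let b_gt0 j : 0 < b j 0. Proof. by have := hb j; rewrite mxE. Qed.

Lemma exp_density_prod x :
  exp_density b x = \prod_j exp_pdf1 (b j 0) (tnth x j).
Proof. exact: exp_densityE. Qed.

Lemma measurable_exp_density : measurable_fun setT (exp_density b).
Proof.
rewrite (_ : exp_density b = fun x => \prod_j exp_pdf1 (b j 0) (tnth x j)).
  by apply: (measurable_prod_tnth (f := fun j => exp_pdf1 (b j 0))) => j;
    exact: measurable_exp_pdf1.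
by apply/funext => x; exact: exp_density_prod.
Qed.

Lemma exp_density_ge0 x : 0 <= exp_density b x.
Proof.
by rewrite exp_density_prod; apply: prodr_ge0 => j _; exact: exp_pdf1_ge0.
Qed.

Lemma exp_measure_probability :
  exists Q : probability (Rn R d) R, (Q : set _ -> \bar R) = exp_measure b.
Proof.
have Q_set0 : exp_measure b set0 = 0%E by rewrite /exp_measure integral_set0.
have Q_ge0 B : (0 <= exp_measure b B)%E.
  by apply: integral_ge0 => x _; rewrite lee_fin exp_density_ge0.
have Q_sigma : semi_sigma_additive (exp_measure b).
  move=> F mF tF mUF; rewrite /exp_measure ge0_integral_bigcup//=.
  - apply: is_cvg_ereal_nneg_natsum => n _; exact: Q_ge0.
  - apply/measurable_EFinP/measurable_funTS; exact: measurable_exp_density.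
  - by move=> x _; rewrite lee_fin exp_density_ge0.
pose Qmix := isMeasure.Build _ _ _ (exp_measure b) Q_set0 Q_ge0 Q_sigma.
pose Qm := HB.pack_for {measure set (Rn R d) -> \bar R} (exp_measure b) Qmix.
pose Q := HB.pack_for (probability (Rn R d) R) (exp_measure b) Qmix
  (Measure_isProbability.Build _ _ _ Qm (exp_measureT hb)).
by exists Q.
Qed.

Lemma has_density_exp_measure : has_density (exp_measure b) (exp_density b).
Proof.
by split => //; [exact: measurable_exp_density|exact: exp_density_ge0].
Qed.

(** The other marginals integrate to 1 by Tonelli. *)
Lemma integral_tnth_exp_density k :
  (\int[mu]_x (tnth x k * exp_density b x)%:E = (b k 0)^-1%:E)%E.
Proof.
pose f j t := (if j == k then t else 1) * exp_pdf1 (b j 0) t.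
have fE x : tnth x k * exp_density b x = \prod_j f j (tnth x j).
  by rewrite exp_density_prod big_split/= -big_mkcond/= big_pred1_eq.
under eq_integral do rewrite fE.
rewrite (@integral_lebesgue_tuple_prod _ _ f).
- rewrite (bigD1 k)//= [X in (X * _)%E](_ : _ = (b k 0)^-1%:E); last first.
    by rewrite -integral_id_exp_pdf1//; apply: eq_integral => t _; rewrite /f eqxx.
  rewrite big1 ?mule1// => j /negbTE jk; rewrite -[RHS](integral_exp_pdf1 (b_gt0 j)).
  by apply: eq_integral => t _; rewrite /f jk mul1r.
- move=> j; apply: measurable_funM; last exact: measurable_exp_pdf1.
  by rewrite /f; case: (j == k).
- move=> j t; rewrite /f; case: (j == k); last by rewrite mul1r exp_pdf1_ge0.
  rewrite /exp_pdf1 patchE; case: ifPn => [|_]; last by rewrite mulr0.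
  by rewrite inE/= in_itv/= andbT => t0; rewrite !mulr_ge0 ?expR_ge0// ltW.
Qed.

(** The coordinates are nonnegative where the density does not vanish, so the
    previous lemma gives their integrability as well as their means. *)
Lemma has_mean_exp_measure m (A : 'M[R]_(m, d)) (Q : probability (Rn R d) R) :
  (Q : set _ -> \bar R) = exp_measure b ->
  has_mean A Q (A *m \col_j (b j 0)^-1).
Proof.
move=> Qb i.
have Qd B : measurable B -> Q B = (\int[mu]_(x in B) (exp_density b x)%:E)%E.
  by move=> _; rewrite Qb.
have mt k : measurable_fun setT (fun x : Rn R d => (tnth x k)%:E).
  by apply/measurable_EFinP; exact: measurable_tnth.
have tI k : Q.-integrable setT (fun x => (tnth x k)%:E).
  apply/integrableP; split => //.
  rewrite (ge0_integral_density measurable_exp_density exp_density_ge0 Qd)//; last first.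
    exact: measurableT_comp.
  rewrite (eq_integral (fun x : Rn R d => (tnth x k * exp_density b x)%:E)).
    by rewrite integral_tnth_exp_density ltry.
  move=> x _; rewrite EFinM; have [x0|x0] := leP 0 (tnth x k : R).
    by rewrite gee0_abs ?lee_fin.
  rewrite /exp_density patchE ifF ?mule0//.
  apply/negbTE; rewrite notin_setE => /(_ k); rewrite !mxE; lra.
have tE k : (\int[Q]_x (tnth x k)%:E = (b k 0)^-1%:E)%E.
  rewrite (integral_density measurable_exp_density exp_density_ge0 Qd)//.
  rewrite -integral_tnth_exp_density; apply: eq_integral => x _.
  by rewrite EFinM.
have AE x : ((A *m vec x) i 0)%:E = (\sum_k (A i k)%:E * (tnth x k)%:E)%E.
  by rewrite mxE -sumEFin; apply: eq_bigr => k _; rewrite mxE EFinM.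
under eq_fun do rewrite AE.
split; first by apply: integrable_sum => // k _; exact: integrableZl.
rewrite integral_sum//; last by move=> k; exact: integrableZl.
rewrite mxE -sumEFin; apply: eq_bigr => k _.
by rewrite integralZl// tE mxE EFinM.
Qed.

End product_exponential.

(** * Gibbs' inequality and the entropy problem *)

Section gibbs.
Context {R : realType} {m d : nat}.
Variables (A : 'M[R]_(m, d)) (c : 'cV[R]_d).
Hypothesis hc : ltv 0 c.
Notation mu := (lebesgue_tuple R d).

Lemma measurable_Omega : measurable (@Omega R d).
Proof.
rewrite (_ : @Omega R d = \bigcap_(j in [set: 'I_d])
    ((fun x : Rn R d => (tnth x j : R)) @^-1` `]0, +oo[%classic)); last first.
  apply/seteqP; split => x /= h.
    by move=> j _ /=; rewrite in_itv/= andbT; have := h j; rewrite !mxE.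
  by move=> j; have := h j I; rewrite /= in_itv/= andbT !mxE.
apply: fin_bigcap_measurable => [|j _]; first exact: finite_finset.
rewrite -[X in measurable X]setTI.
by apply: (measurable_tnth (T := measurableTypeR R) j) => //; exact: measurable_itv.
Qed.

Lemma exp_const_gt0 (b : 'cV[R]_d) : ltv 0 b -> 0 < exp_const b.
Proof.
by move=> hb; apply: prodr_gt0 => j _; have := hb j; rewrite mxE.
Qed.

Lemma ln_exp_const (b : 'cV[R]_d) : ltv 0 b -> ln (exp_const b) = \sum_j ln (b j 0).
Proof.
move=> hb; rewrite /exp_const.
suff [] : ln (\prod_j b j 0) = \sum_j ln (b j 0) /\ 0 < \prod_j b j 0 by [].
apply: (big_rec2 (fun p s => ln p = s /\ 0 < p)); first by rewrite ln1.
move=> j p s _ [<- p0]; have := hb j; rewrite mxE => bj.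
by rewrite lnM ?posrE// mulr_gt0.
Qed.

Lemma exp_density_gt0 (b : 'cV[R]_d) x : ltv 0 b -> Omega x -> 0 < exp_density b x.
Proof.
move=> hb Ox; rewrite /exp_density patchE mem_set// mulr_gt0 ?expR_gt0//.
exact: exp_const_gt0.
Qed.

(** The log-ratio is affine in [A x], so the moment constraint alone fixes its
    integral against any admissible law. *)
Lemma ln_exp_density_ratio l x : ltv 0 (slack A c l) -> Omega x ->
  ln (exp_density (slack A c l) x / exp_density c x) =
  \sum_j ln (slack A c l j 0) - ln (exp_const c) + dotp l (A *m vec x).
Proof.
move=> hb Ox; rewrite ln_div ?posrE; [|exact: exp_density_gt0..].
rewrite /exp_density !patchE mem_set// !lnM ?posrE ?expR_gt0//; [|exact: exp_const_gt0..].
by rewrite !expRK ln_exp_const// (dotp_slack A c); ring.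
Qed.

Lemma integral_exp_density_Omega (b : 'cV[R]_d) : ltv 0 b ->
  mu.-integrable (@Omega R d) (EFin \o exp_density b) /\
  (\int[mu]_(x in @Omega R d) (exp_density b x)%:E = 1)%E.
Proof.
move=> hb.
have p1 : (\int[mu]_(x in @Omega R d) (exp_density b x)%:E = 1)%E.
  rewrite -(exp_measureT hb) /exp_measure integral_mkcond; apply: eq_integral => x _.
  by rewrite patchE; case: ifPn => // /negbTE xO; rewrite /exp_density patchE xO.
split=> //; apply/integrableP; split.
  by apply/measurable_EFinP/measurable_funTS; exact: measurable_exp_density.
under eq_integral do rewrite gee0_abs ?lee_fin ?exp_density_ge0//.
by rewrite p1 ltry.
Qed.

(** All the densities are positive on [Omega] and vanish off it, so they have the
    same null sets. *)
Lemma exp_measure_dominates (b : 'cV[R]_d) : ltv 0 b ->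
  exp_measure b `<< exp_measure c.
Proof.
move=> hb N N0 B mB BN.
have mp (b' : 'cV[R]_d) : ltv 0 b' -> measurable_fun B (EFin \o exp_density b').
  by move=> hb'; apply/measurable_EFinP/measurable_funTS; exact: measurable_exp_density.
have PB : (\int[mu]_(x in B) `|(EFin \o exp_density c) x| = 0)%E.
  rewrite -(N0 _ mB BN); apply: eq_integral => x _.
  by rewrite gee0_abs// lee_fin exp_density_ge0.
have c_ae := (ae_eq_integral_abs mu mB (mp c hc)).1 PB.
rewrite /exp_measure -[RHS](integral0 mu B); apply: ae_eq_integral => //; first exact: mp.
apply: filterS c_ae => x h /h /= [c0].
have [Ox|nOx] := pselect (Omega x); first by have := exp_density_gt0 hc Ox; rewrite c0 ltxx.
by rewrite /exp_density patchE memNset.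
Qed.

Section admissible.
Variables (Q : probability (Rn R d) R) (q : Rn R d -> R) (y : 'cV[R]_m).
Hypotheses (Qc : Q `<< exp_measure c) (Qq : has_density Q q) (Qy : has_mean A Q y).

Lemma null_setC_Omega : Q (~` @Omega R d) = 0%E.
Proof.
apply: (Qc _ (measurableC measurable_Omega) (@subset_refl _ _)) => B mB BO.
rewrite /exp_measure integral0_eq// => x /BO /= xO.
by rewrite /exp_density patchE memNset.
Qed.

(** [Q] is carried by [Omega], so integrating over [Omega] loses nothing. *)
Lemma integral_affine_mean K l :
  let f x := (q x * (K + dotp l (A *m vec x)))%:E in
  mu.-integrable (@Omega R d) f /\
  (\int[mu]_(x in @Omega R d) f x = (K + dotp l y)%:E)%E.
Proof.
have [mq q0 QE] := Qq; have mO := measurable_Omega.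
pose g (x : Rn R d) := (K%:E + \sum_i (l i 0)%:E * ((A *m vec x) i 0)%:E)%E.
have gE x : g x = (K + dotp l (A *m vec x))%:E.
  by rewrite /g EFinD -sumEFin; congr (_ + _)%E; apply: eq_bigr => i _; rewrite EFinM.
have lI i : Q.-integrable setT (fun x => (l i 0)%:E * ((A *m vec x) i 0)%:E)%E.
  by apply: integrableZl => //; exact: (Qy i).1.
have sI : Q.-integrable setT
    (fun x => \sum_i (l i 0)%:E * ((A *m vec x) i 0)%:E)%E.
  by apply: integrable_sum.
have KI : Q.-integrable setT (fun=> K%:E).
  exact: finite_measure_integrable_cst.
have gI : Q.-integrable setT g by exact: integrableD.
have gIO : Q.-integrable (@Omega R d) g by apply: integrableS gI.
have Eg : (\int[Q]_x g x = (K + dotp l y)%:E)%E.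
  rewrite integralD//= integral_cst//= probability_setT mule1 EFinD; congr (_ + _)%E.
  rewrite integral_sum// -sumEFin; apply: eq_bigr => i _.
  by rewrite integralZl//; [rewrite (Qy i).2 EFinM|exact: (Qy i).1].
have fE x : (q x * (K + dotp l (A *m vec x)))%:E = (g x * (q x)%:E)%E.
  by rewrite gE -EFinM mulrC.
rewrite /=; under [X in _ /\ X = _]eq_integral do rewrite fE.
split.
  rewrite (_ : (fun x => _) = (fun x => g x * (q x)%:E)%E); last exact/funext.
  exact: (integrable_density mq q0 QE).
rewrite -(integral_density mq q0 QE)//; last exact: (measurable_int Q).
rewrite -Eg (negligible_integral (measurableC mO) measurableT gI null_setC_Omega).
by rewrite setTD setCK.
Qed.

(** With [p] the density of rates [slack A c l], the bound [ln u <= u - 1] at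
    [u = p / q] gives [q ln (q / p_c) >= q ln (p / p_c) + q - p], whose right-hand
    side is integrable with known integral. *)
Lemma KL_ge l : ltv 0 (slack A c l) ->
  ((\sum_j ln (slack A c l j 0) - ln (exp_const c) + dotp l y)%:E
   <= KL q (exp_density c))%E.
Proof.
move=> hb; have [mq q0 _] := Qq; have mO := measurable_Omega.
set K := \sum_j _ - _; set p := exp_density (slack A c l).
have [fI fE] := integral_affine_mean (K + 1) l.
have [pI pE] := integral_exp_density_Omega hb.
rewrite (_ : (K + dotp l y)%:E = (K + 1 + dotp l y)%:E - 1)%E; last first.
  by rewrite -EFinB; congr EFin; ring.
rewrite -fE -pE -integralB// /KL.
apply: integrable_le_integral => //; first exact: integrableB.
  (* On [Omega] the integrand is [q (ln q - ln p_c)], also where [q] vanishes,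
     since [0 * _ = 0]; this form is visibly measurable. *)
  apply: (eq_measurable_fun
    (fun x => (q x * (ln (q x) - ln (exp_density c x)))%:E)).
    move=> x /set_mem Ox; congr EFin.
    have [->|qx0] := eqVneq (q x) 0; first by rewrite !mul0r.
    by rewrite ln_div ?posrE ?exp_density_gt0// lt_def qx0 q0.
  apply/measurable_EFinP/measurable_funTS/measurable_funM => //.
  apply: measurable_funB; first exact: measurableT_comp.
  by apply: measurableT_comp => //; exact: measurable_exp_density.
move=> x Ox; rewrite /= -EFinB lee_fin.
have pc0 := exp_density_gt0 hc Ox; have pb0 := exp_density_gt0 hb Ox.
have [qx0|qx0] := eqVneq (q x) 0; first by rewrite qx0 !mul0r sub0r oppr_le0 ltW.
have {q0}qx : 0 < q x by rewrite lt_def qx0 q0.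
have -> : q x / exp_density c x = (p x / exp_density c x) / (p x / q x).
  by field; rewrite ?gt_eqF.
rewrite ln_div ?posrE ?divr_gt0// ln_exp_density_ratio// -/K.
have := @ln_le_subr1 _ (p x / q x); rewrite divr_gt0// => /(_ isT).
move=> /(ler_wpM2l (ltW qx)) h.
have : q x * (p x / q x - 1) = p x - q x by field; rewrite gt_eqF.
by rewrite -/p; lra.
Qed.

End admissible.

(** The infimum is attained by the exponential law of rates [slack A c l], whose
    mean is the admissible one exactly when [l] is stationary. *)
Lemma Theta_center e y l : 0 < e -> ltv (A^T *m l) c ->
  A *m (\col_j (e / slack A c l j 0)) = y ->
  Theta A c (e^-1 *: y) =
  (\sum_j ln (slack A c l j 0) - ln (exp_const c) + dotp l (e^-1 *: y))%:E.
Proof.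
move=> e0 /slack_gt0 lc Ay.
have hb : ltv 0 (slack A c l) by move=> j; rewrite mxE.
apply/eqP; rewrite eq_le; apply/andP; split; last first.
  by apply: le_ereal_inf_tmp => _ [Q [q [Qc Qq Qy ->]]]; have := KL_ge Qc Qq Qy hb.
have [Q QE] := exp_measure_probability hb.
have Qq : has_density Q (exp_density (slack A c l)).
  by rewrite QE; exact: has_density_exp_measure.
have Qy : has_mean A Q (e^-1 *: y).
  rewrite -Ay scalemxAr (_ : _ *: _ = \col_j (slack A c l j 0)^-1).
    exact: has_mean_exp_measure.
  by apply/matrixP => j k; rewrite !mxE mulKf// gt_eqF.
have Qc : Q `<< exp_measure c.
  by rewrite QE; exact: exp_measure_dominates.
apply: ereal_inf_lbound; exists Q, (exp_density (slack A c l)); split => //.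
rewrite -(integral_affine_mean Qc Qq Qy _ l).2 /KL.
apply: eq_integral => x /set_mem Ox; by rewrite ln_exp_density_ratio.
Qed.

End gibbs.

(** * The perspective function *)

Section perspective.
Context {R : realType} {m d : nat}.
Variables (A : 'M[R]_(m, d)) (c : 'cV[R]_d).

Lemma barrier_valueE y e l : ltv (A^T *m l) c ->
  (forall l', ltv (A^T *m l') c -> barrier A c y e l' <= barrier A c y e l) ->
  barrier_value A c y e = (barrier A c y e l)%:E.
Proof.
move=> lc lmax; apply/eqP; rewrite eq_le; apply/andP; split.
  by apply: ge_ereal_sup => _ [l' l'c <-]; rewrite lee_fin; exact: lmax.
by apply: ereal_sup_ubound; exists l.
Qed.

Lemma persp_Theta_center y e l : ltv 0 c -> 0 < e -> ltv (A^T *m l) c ->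
  A *m (\col_j (e / slack A c l j 0)) = y ->
  persp_Theta A c y e = (- e * ln (exp_const c) + barrier A c y e l)%:E.
Proof.
move=> hc e0 lc Al; rewrite /persp_Theta (Theta_center hc e0 lc Al) -EFinM.
congr EFin; rewrite dotpZr /barrier; field; by rewrite gt_eqF.
Qed.

End perspective.

Theorem theorem4p1 (R : realType) (m d : nat) (A : 'M[R]_(m, d))
    (c : 'cV[R]_d) (lambda0 : 'cV[R]_m) (y : 'cV[R]_m)
    (hmd : (m < d)%N)
    (hA : row_free A)
    (hc : ltv 0 c)
    (hlambda0 : ltv (A^T *m lambda0) c)
    (hy : interior (cone A) y) :
  (forall eps : R, 0 < eps ->
     persp_Theta A c y eps
     = ((- eps * ln (exp_const c))%:E + barrier_value A c y eps)%E) /\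
  (persp_Theta A c y r @[r --> 0^'+] --> lp_value A c y) /\
  (exists2 x : 'cV[R]_d, lp_feasible A y x & (dotp c x)%:E = lp_value A c y).
Proof.
have center (r : R) : 0 < r -> exists l, [/\ ltv (A^T *m l) c,
    A *m (\col_j (r / slack A c l j 0)) = y &
    forall l', ltv (A^T *m l') c -> barrier A c y r l' <= barrier A c y r l].
  move=> r0; have [l lc lmax] := barrier_max hA r0 hy hlambda0.
  by exists l; split => //; exact: barrier_stationary lc lmax.
split.
  move=> e e0; have [l [lc Al lmax]] := center _ e0.
  by rewrite (persp_Theta_center hc e0 lc Al) (barrier_valueE lc lmax) EFinD.
have [x' x'0 Ax'] := interior_cone_pos hy.
have x'y : lp_feasible A y x' by split => // j; exact/ltW.
have [x xy xmin] : exists2 x, lp_feasible A y x &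
    forall z, lp_feasible A y z -> dotp c x <= dotp c z.
  by apply: (lp_min hc); exists x'.
have lpE : lp_value A c y = (dotp c x)%:E.
  apply/eqP; rewrite eq_le; apply/andP; split.
    by apply: ereal_inf_lbound; exists x.
  by apply: le_ereal_inf_tmp => _ [z zy <-]; rewrite lee_fin; exact: xmin.
split; last by exists x.
rewrite lpE.
(* [G] is the barrier value as a real function of [r]. *)
pose G r := fine (persp_Theta A c y r) + r * ln (exp_const c).
have GE r : 0 < r -> persp_Theta A c y r = (G r - r * ln (exp_const c))%:E.
  move=> r0; have [l [lc Al _]] := center _ r0.
  by rewrite /G (persp_Theta_center hc r0 lc Al) /= addrK.
have Gcvg : G r @[r --> (0 : R)^'+] --> dotp c x.
  apply: (barrier_center_cvg hc hy xy xmin) => r r0.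
  have [l [lc Al _]] := center _ r0; exists l; split => //.
  by rewrite /G (persp_Theta_center hc r0 lc Al)/=; ring.
have : (G r - r * ln (exp_const c))%:E @[r --> (0 : R)^'+] --> (dotp c x)%:E.
  apply: cvg_EFin; first by near=> r.
  rewrite [X in _ --> X](_ : _ = dotp c x - 0 * ln (exp_const c)); last first.
    by rewrite mul0r subr0.
  apply: cvgB => //; apply: cvgMr_tmp; apply: cvg_at_right_filter; exact: cvg_id.
apply: cvg_trans; apply: near_eq_cvg; by near=> r; rewrite GE.
Unshelve. all: by end_near. Qed.
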